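(* Let $\Gamma$ be a countable discrete amenable group and let $\alpha:\Gamma\curvearrowright X$ be an action on an infinite compact metrizable space $X$ that is almost finite in measure. Then $\alpha$ is essentially free.
   Context: All actions are by homeomorphisms. $M_\Gamma(X)$ is the set of $\Gamma$-invariant Borel probability measures on $X$. The action is essentially free if for every $s\in\Gamma\setminus\{e\}$ the set $F_s=\{x\in X: sx=x\}$ satisfies $\sup_{\mu\in M_\Gamma(X)}\mu(F_s)=0$. Fix a compatible metric on $X$. For finite $K\subset\Gamma$ and $\epsilon>0$, a finite set $S\subset\Gamma$ is $(K,\epsilon)$-F{\o}lner if $|KS\setminus S|<\epsilon|S|$. A tower is a pair $(S,B)$ with $S\subset\Gamma$ finite and $B\subset X$ such that the sets $sB$, $s\in S$, are pairwise disjoint; $S$ is its shape and $B$ its base. A castle is a finite family of towers $\{(S_i,B_i): i\in I\}$ such that $sB_i\cap tB_j=\emptyset$ for all $s\in S_i$, $t\in S_j$, $i\neq j$; it is open if all $B_i$ are open. The action is almost finite in measure if for every finite $K\subset\Gamma$ and $\epsilon>0$ there is an open castle $\{(S_i,B_i): i\in I\}$ such that (i) each $S_i$ is $(K,\epsilon)$-F{\o}lner; (ii) $\operatorname{diam}(sB_i)<\epsilon$ for all $s\in S_i$, $i\in I$; (iii) $\sup_{\mu\in M_\Gamma(X)}\mu\big(X\setminus\bigsqcup_{i\in I}S_iB_i\big)<\epsilon$. *)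

(* Defs.v *)
From HB Require Import structures.
From mathcomp Require Import all_boot all_order all_algebra finmap.
From mathcomp Require Import all_classical all_reals all_analysis.
Set Implicit Arguments.
Unset Strict Implicit.
Unset Printing Implicit Defensive.
Import Order.TTheory GRing.Theory Num.Theory.
Local Open Scope classical_set_scope.
Local Open Scope ring_scope.

(* MathComp-Analysis measurable types are pointed, so the
   Borel sigma-algebra of a metric space needs a base point; an infinite space
   is nonempty, so this is no restriction. *)
#[short(type="pMetricType")]
HB.structure Definition PointedMetric (R : numDomainType) :=
  {T of Pointed T & Metric R T}.

(* The inverse of [act s] is [act s^-1], so every [act s] is a homeomorphism. *)
Record homeo_action (G : groupType) (X : topologicalType) := HomeoAction {
  act :> G -> X -> X ;
  act1 : forall x, act 1%g x = x ;
  actM : forall s t x, act (s * t)%g x = act s (act t x) ;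
  act_continuous : forall s, continuous (act s)
}.

(* Amenability of a discrete group in von Neumann's form: a left-invariant
   finitely additive probability measure on all subsets. *)
Definition amenable (R : realType) (G : groupType) : Prop :=
  exists m : set G -> R,
    [/\ forall A, 0 <= m A,
        m [set: G] = 1,
        forall A B, A `&` B = set0 -> m (A `|` B) = m A + m B
      & forall s A, m [set (s * t)%g | t in A] = m A].

Definition borel (R : realType) (X : pMetricType R) :=
  g_sigma_algebraType (@open X).

Definition invariant_probability (R : realType) (G : groupType)
    (X : pMetricType R) (a : homeo_action G X) : set (probability (borel X) R) :=
  [set mu | forall s (A : set (borel X)), measurable A -> mu (a s @` A) = mu A].

(* The supremum of mu(A) over invariant mu, as a real number: the values lie in
   [0, 1].  There is an invariant mu when G is amenable and X is compact and
   nonempty; otherwise [sup set0 = 0]. *)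
Definition sup_measure (R : realType) (G : groupType) (X : pMetricType R)
    (a : homeo_action G X) (A : set X) : R :=
  sup [set fine (mu A) | mu in invariant_probability a].

Definition fixed_points (G : groupType) (X : topologicalType)
    (a : homeo_action G X) (s : G) : set X := [set x | a s x = x].

Definition essentially_free (R : realType) (G : groupType) (X : pMetricType R)
    (a : homeo_action G X) : Prop :=
  forall s : G, s != 1%g -> sup_measure a (fixed_points a s) = 0.

Definition folner (R : realType) (G : groupType) (K : {fset G}) (eps : R)
    (S : {fset G}) : Prop :=
  #|` ([fset (k * s)%g | k in K, s in S] `\` S)%fset |%:R < eps * #|` S|%:R.

Definition tower (G : groupType) (X : topologicalType) (a : homeo_action G X)
    (S : {fset G}) (B : set X) : Prop :=
  trivIset [set` S] (fun s => a s @` B).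

Definition castle (G : groupType) (X : topologicalType) (a : homeo_action G X)
    (I : finType) (S : I -> {fset G}) (B : I -> set X) : Prop :=
  (forall i, tower a (S i) (B i)) /\
  (forall i j s t, i != j -> s \in S i -> t \in S j ->
     (a s @` B i) `&` (a t @` B j) = set0).

Definition open_castle (G : groupType) (X : topologicalType)
    (a : homeo_action G X) (I : finType) (S : I -> {fset G})
    (B : I -> set X) : Prop :=
  castle a S B /\ forall i, open (B i).

Definition footprint (G : groupType) (X : topologicalType)
    (a : homeo_action G X) (I : finType) (S : I -> {fset G})
    (B : I -> set X) : set X :=
  \bigcup_(i in [set: I]) \bigcup_(s in [set` S i]) (a s @` B i).

(* Used for compact X only, where distances are bounded; the diameter of the
   empty set is 0. *)
Definition diam (R : realType) (X : metricType R) (A : set X) : R :=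
  sup [set r | exists x y, [/\ A x, A y & r = mdist x y]].

Definition almost_finite_in_measure (R : realType) (G : groupType)
    (X : pMetricType R) (a : homeo_action G X) : Prop :=
  forall (K : {fset G}) (eps : R), 0 < eps ->
    exists (I : finType) (S : I -> {fset G}) (B : I -> set X),
      [/\ open_castle a S B,
          forall i, folner K eps (S i),
          forall i s, s \in S i -> diam (a s @` B i) < eps
        & sup_measure a (~` footprint a S B) < eps].

(* Main.v *)
Require Import Defs.
From mathcomp Require Import all_boot all_order all_algebra finmap.
From mathcomp Require Import all_classical all_reals all_analysis.
Local Open Scope classical_set_scope.

(** A fixed point of [s] cannot sit in a level [t B] of a tower [(S, B)] when
    [s t] is again in [S]: it would lie in both [t B] and [s t B], which are
    disjoint because [s != 1] gives [s t != t]. So, inside the footprint of a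
    castle, the fixed points of [s] are confined to the levels [t B_i] with
    [s t] outside [S_i] ([tower_fixed_points]). If the shapes are
    ([{s}], [eps])-Folner, these are fewer than [eps * |S_i|] of the [|S_i|]
    levels of the tower ([card_exits]). All the levels of a tower have the same
    measure for an invariant probability [mu], and all the levels of the castle
    together have measure at most 1 ([sum_tower_le1]), so the exceptional levels
    have measure at most [eps]. Adding the complement of the footprint,
    [mu (F_s) <= mu (~` footprint) + eps] ([measure_fixed_points_castle]).
    Almost finiteness in measure makes both terms arbitrarily small. *)

Import Order.TTheory GRing.Theory Num.Theory.
Local Open Scope ring_scope.

Lemma actK {G : groupType} {X : topologicalType} (a : homeo_action G X)
  (s : G) : cancel (a s) (a s^-1%g).
Proof. by move=> x; rewrite -actM mulVg act1. Qed.

Lemma open_act_image {G : groupType} {X : topologicalType}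
    (a : homeo_action G X) (s : G) {B : set X} :
  open B -> open (a s @` B).
Proof.
move=> oB; have -> : a s @` B = a s^-1%g @^-1` B.
  apply/seteqP; split=> [_ [x Bx <-]|x Bx] /=; first by rewrite actK.
  by exists (a s^-1%g x) => //; rewrite -actM mulgV act1.
by apply: open_comp oB => x _; apply: (@act_continuous _ _ a).
Qed.

Lemma closed_fixed_points {G : groupType} {X : topologicalType}
    (a : homeo_action G X) (s : G) :
  hausdorff_space X -> closed (fixed_points a s).
Proof.
move=> hX x clx; apply: hX => A B Ax Bx.
have /clx[y [fy [Ay By]]] : nbhs x (a s @^-1` A `&` B).
  by apply: filterI => //; apply: (@act_continuous _ _ a s x).
by exists y; split => //; rewrite -fy.
Qed.

(** These index the only levels of a tower of shape [S] that may contain fixed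
    points of [s]. *)
Definition exits {G : groupType} (s : G) (S : {fset G}) : {fset G} :=
  [fset t in S | (s * t)%g \notin S]%fset.

(** Translation by [s] is a bijection from [exits s S] onto the part of [s S]
    outside [S], which is the set counted in the Folner condition for [{s}]. *)
Lemma card_exits {G : groupType} (s : G) (S : {fset G}) :
  #|` exits s S| = #|` ([fset (k * t)%g | k in [fset s], t in S] `\` S)%fset|.
Proof.
have -> : ([fset (k * t)%g | k in [fset s], t in S] `\` S)%fset
    = [fset (s * t)%g | t in exits s S]%fset.
  apply/fsetP => u; apply/idP/idP.
    rewrite inE => /andP[uS /imfset2P[k /=]]; rewrite inE => /eqP -> [t tS ut].
    by apply/imfsetP; exists t => //=; rewrite !inE/= tS -ut.
  case/imfsetP => t /=; rewrite !inE/= => /andP[tS stS] ->.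
  by rewrite stS; apply/imfset2P; exists s; rewrite ?inE//; exists t.
by rewrite [RHS]card_imfset// => x y; exact: mulgI.
Qed.

Lemma tower_fixed_points {G : groupType} {X : topologicalType}
    {a : homeo_action G X} {s t : G} {S : {fset G}} {B : set X} {x : X} :
  s != 1%g -> tower a S B -> t \in S -> (a t @` B) x -> fixed_points a s x ->
  t \in exits s S.
Proof.
move=> s1 towS tS [b Bb <-{x}]; rewrite /fixed_points/= -actM => fx.
rewrite !inE/= tS/=; apply/negP => stS.
move/eqP: s1; apply.
have : (s * t)%g = t.
  apply: towS => //; exists (a t b); split; last by exists b.
  by exists b.
by move/(congr1 (fun g => g * t^-1)%g); rewrite mulgK mulgV.
Qed.

Lemma open_measurable_borel {R : realType} {X : pMetricType R} {A : set X} :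
  open A -> measurable (A : set (borel X)).
Proof. exact: sub_sigma_algebra. Qed.

(** Stated for a part [T] of the shape because both cases are needed: [T = S] to
    bound the whole castle by 1, [T = exits s S] for the exceptional levels. *)
Lemma measure_partial_tower {R : realType} {G : groupType} {X : pMetricType R}
    {a : homeo_action G X} {mu : probability (borel X) R} {S T : {fset G}}
    {B : set X} :
  invariant_probability a mu -> open B -> tower a S B -> {subset T <= S} ->
  mu (\bigcup_(t in [set` T]) (a t @` B)) = (#|` T|%:R * fine (mu B))%:E.
Proof.
move=> inv oB tow TS.
have mB : measurable (B : set (borel X)) by exact: open_measurable_borel.
have mtB t : measurable (a t @` B : set (borel X)).
  by apply: open_measurable_borel; exact: open_act_image.
rewrite measure_fin_bigcup//; last first.
  exact: (sub_trivIset (D' := [set` S])).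
rewrite -fsbig_seq//.
have mutB t : mu (a t @` B) = (fine (mu B))%:E.
  by rewrite fineK ?fin_num_measure//; exact: inv.
rewrite (eq_bigr _ (fun t _ => mutB t)).
by rewrite sumEFin big_const_seq count_predT iter_addr_0 mulr_natl.
Qed.

Lemma sum_tower_le1 {R : realType} {G : groupType} {X : pMetricType R}
    {a : homeo_action G X} {mu : probability (borel X) R} {I : finType}
    {S : I -> {fset G}} {B : I -> set X} :
  invariant_probability a mu -> open_castle a S B ->
  \sum_(i in I) #|` S i|%:R * fine (mu (B i)) <= 1.
Proof.
move=> inv [[tow dis] oB].
pose T i : set (borel X) := \bigcup_(t in [set` S i]) (a t @` B i).
have mT i : measurable (T i).
  by apply: open_measurable_borel; apply: bigcup_open => t _;
    apply: open_act_image.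
rewrite -lee_fin -sumEFin.
rewrite -(eq_bigr _
  (fun i _ => measure_partial_tower inv (oB i) (tow i) (fun t h => h))).
have triv : trivIset [set` index_enum I] T.
  apply/trivIsetP => i j _ _ ij; rewrite -subset0 => x [[s sS sx] [t tS tx]].
  by rewrite -(dis i j s t ij sS tS).
rewrite fsbig_seq; last exact: index_enum_uniq.
rewrite -measure_fin_bigcup//; last by move=> i _; exact: mT.
by apply: probability_le1; apply: fin_bigcup_measurable => // i _; exact: mT.
Qed.

(** Measurability of [A] is what keeps [mu A] at most 1; without it the set of
    values might be unbounded and its supremum a junk value. *)
Lemma sup_measure_ge {R : realType} {G : groupType} {X : pMetricType R}
    {a : homeo_action G X} {mu : probability (borel X) R} {A : set X} :
  invariant_probability a mu -> measurable (A : set (borel X)) ->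
  fine (mu A) <= sup_measure a A.
Proof.
move=> inv mA; apply: ub_le_sup; last by exists mu.
exists 1 => _ [nu _ <-].
by rewrite -lee_fin fineK ?fin_num_measure// probability_le1.
Qed.

(** Outside the footprint nothing is known about the fixed points; inside it
    they lie in exceptional levels, a proportion below [eps] of each tower. *)
Lemma measure_fixed_points_castle {R : realType} {G : groupType}
    {X : pMetricType R} {a : homeo_action G X} {mu : probability (borel X) R}
    {I : finType} {S : I -> {fset G}} {B : I -> set X} {s : G} {eps : R} :
  s != 1%g -> invariant_probability a mu -> open_castle a S B ->
  (forall i, folner [fset s]%fset eps (S i)) -> 0 <= eps ->
  fine (mu (fixed_points a s)) <=
    fine (mu (~` footprint a S B)) + eps.
Proof.
move=> s1 inv opc fol eps0.
have [[tow _] oB] := opc.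
have mF : measurable (fixed_points a s : set (borel X)).
  rewrite -(setCK (fixed_points a s)); apply: measurableC.
  apply: open_measurable_borel; rewrite openC.
  by apply: closed_fixed_points; exact: metric_hausdorff.
have ofp : open (footprint a S B).
  by apply: bigcup_open => i _; apply: bigcup_open => t _; apply: open_act_image.
have mfp : measurable (~` footprint a S B : set (borel X)).
  by apply: measurableC; exact: open_measurable_borel.
pose T i : set (borel X) :=
  \bigcup_(t in [set` exits s (S i)]) (a t @` B i).
have mT i : measurable (T i).
  by apply: open_measurable_borel; apply: bigcup_open => t _;
    apply: open_act_image.
pose U : set (borel X) := \bigcup_(i in [set` index_enum I]) T i.
have mU : measurable U by apply: fin_bigcup_measurable.
have cover : fixed_points a s `<=` (~` footprint a S B) `|` U.
  move=> x fx; have [[i _ [t tS tx]]|] := pselect (footprint a S B x); last by left.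
  right; exists i; first by rewrite /= mem_index_enum.
  by exists t => //; exact: tower_fixed_points (tow i) tS tx fx.
rewrite -lee_fin EFinD !fineK ?fin_num_measure//.
apply: le_trans (le_measure mu _ _ cover) _; rewrite ?inE//.
  exact: measurableU.
apply: le_trans (measureU2 _ _ _) _ => //.
rewrite leeD2l//.
apply: le_trans (content_sub_fsum _ _ (A_ := T) _ _ (fun x h => h)) _ => //.
rewrite -fsbig_seq ?index_enum_uniq//.
have exS i : {subset exits s (S i) <= S i}.
  by move=> t; rewrite !inE/= => /andP[].
rewrite (eq_bigr _
  (fun i _ => measure_partial_tower inv (oB i) (tow i) (exS i))).
rewrite sumEFin lee_fin.
apply: (@le_trans _ _ (eps * \sum_(i in I) #|` S i|%:R * fine (mu (B i)))).
  (* Compare tower by tower, where the Folner condition applies. *)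
  rewrite mulr_sumr; apply: ler_sum => i _; rewrite mulrA.
  apply: ler_wpM2r; first exact: fine_ge0.
  by rewrite card_exits ltW//; exact: fol.
by rewrite ler_piMr//; exact: sum_tower_le1 inv opc.
Qed.

Theorem proposition3p6 (R : realType) (G : groupType) (X : pMetricType R)
    (alpha : homeo_action G X) :
  countable [set: G] ->
  amenable R G ->
  compact [set: X] ->
  infinite_set [set: X] ->
  almost_finite_in_measure alpha ->
  essentially_free alpha.
Proof.
move=> _ _ _ _ af s s1.
have null (mu : probability (borel X) R) : invariant_probability alpha mu ->
    fine (mu (fixed_points alpha s)) = 0.
  move=> inv; apply/eqP; rewrite eq_le fine_ge0// andbT.
  apply/ler_addgt0Pl => e e0; rewrite addr0.
  have [|I [S [B [opc fol _ small]]]] := af [fset s]%fset (e / 2).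
    by rewrite divr_gt0.
  rewrite (splitr e).
  apply: le_trans (measure_fixed_points_castle s1 inv opc fol _) _.
    by rewrite divr_ge0// ltW.
  rewrite lerD2r; apply: le_trans (ltW small).
  apply: sup_measure_ge inv _; apply: measurableC; apply: open_measurable_borel.
  by apply: bigcup_open => i _; apply: bigcup_open => t _;
    apply: open_act_image; apply: opc.2.
(* With no invariant probability, the supremum is that of the empty set. *)
rewrite /sup_measure.
have [->|/set0P[mu0 inv0]] := eqVneq (invariant_probability alpha) set0.
  by rewrite image_set0 sup0.
rewrite (_ : image _ _ = [set 0]) ?sup1//.
apply/seteqP; split=> [_ [mu inv <-]|_ ->] /=; first exact: null.
by exists mu0 => //; exact: null.
Qed.
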